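(* Let $p,q\ge2$ be coprime integers and let $c\in\mathbb{C}$ with $c\ne 2\cos\pi\left(\frac{ra}{p}\pm\frac{sb}{q}\right)$ for all pairs of integers $(a,b)$ with $0<a<p$, $0<b<q$, $a\equiv b\pmod 2$. For an integer $k$ let $\varepsilon_k\in\{0,1\}$ be the residue of $k$ modulo $2$. Then for every integer $m\ge0$, $$\sum_{\substack{\text{acyclic }[\rho]\in\mathcal{X}_2^*\\ \mathrm{tr}\,\rho(\mu)=c}}\frac{1}{(\tau_\rho)^m}=\left(\frac{p}{2^{m+1}}\sum_{l=-\lfloor m/p\rfloor}^{\lfloor m/p\rfloor}(-1)^{(p+1)l}\binom{2m}{m+pl}-2^{m-1}\varepsilon_p\right)\left(\frac{q}{2^{m+1}}\sum_{l=-\lfloor m/q\rfloor}^{\lfloor m/q\rfloor}(-1)^{(q+1)l}\binom{2m}{m+ql}-2^{m-1}\varepsilon_q\right)\in\frac{1}{4^m}\mathbb{Z}.$$ In particular, for $m=1$ the sum equals $\left(\frac p2-\varepsilon_p\right)\left(\frac q2-\varepsilon_q\right)$.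
   Context: $K_{p,q}\subset S^3$ is the torus knot of type $(p,q)$ with exterior $E(K_{p,q})$, $G_{p,q}=\langle x,y\mid x^p=y^q\rangle$ its group, and $\mu=x^{-r}y^s$ its meridian, where $(r,s)$ is a fixed pair of integers with $ps-qr=1$. $\mathcal{X}_2^*$ is the set of conjugacy classes (characters) of irreducible representations $\rho\colon G_{p,q}\to\mathrm{SL}_2(\mathbb{C})$; $\rho$ is acyclic if $H_*(E(K_{p,q});\mathbb{C}^2_\rho)=0$. Known facts: $\mathcal{X}_2^*$ is the disjoint union of components $\mathcal{X}^*_{2,(a,b)}$ indexed by integer pairs with $0<a<p$, $0<b<q$, $a\equiv b\pmod 2$; for $[\rho]\in\mathcal{X}^*_{2,(a,b)}$ one has $\mathrm{tr}\,\rho(x)=2\cos\frac{\pi a}{p}$, $\mathrm{tr}\,\rho(y)=2\cos\frac{\pi b}{q}$, $\rho(x^p)=\rho(y^q)=(-I)^a$, and $\mathrm{tr}\,\rho(\mu)\ne2\cos(\frac{\pi ra}{p}\pm\frac{\pi sb}{q})$; $\mathrm{tr}\,\rho(\mu)$ is a parameter on the component, so for $c$ as in the claim each component contains exactly one class with $\mathrm{tr}\,\rho(\mu)=c$. A representation on $\mathcal{X}^*_{2,(a,b)}$ is acyclic if and only if $a$ and $b$ are odd, and then its Reidemeister torsion (with the sign chosen so that the following holds) is $$\tau_\rho=\tau_\rho(E(K_{p,q}))=\frac{1}{4\sin^2\frac{a\pi}{2p}\sin^2\frac{b\pi}{2q}} .$$ *)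

(* Defs.v *)
From HB Require Import structures.
From mathcomp Require Import all_boot all_order all_algebra.
From mathcomp Require Import generic_quotient.
From mathcomp Require Import all_classical all_reals all_analysis.
From mathcomp Require Export complex.

Set Implicit Arguments.
Unset Strict Implicit.
Unset Printing Implicit Defensive.

Import Order.TTheory GRing.Theory Num.Theory.
Local Open Scope quotient_scope.
Local Open Scope classical_set_scope.
Local Open Scope ring_scope.

(* A letter (k, false) is the k-th generator and (k, true) its inverse. *)
Definition letter := ('I_2 * bool)%type.
Definition word := seq letter.
Definition inv_letter (l : letter) : letter := (l.1, ~~ l.2).
Definition inv_word (u : word) : word := rev (map inv_letter u).

(* u and v represent the same element of < x, y | w >. *)
Inductive pres_eq (w : word) : word -> word -> Prop :=
| pres_refl u : pres_eq w u u
| pres_sym u v : pres_eq w u v -> pres_eq w v u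
| pres_trans v u t : pres_eq w u v -> pres_eq w v t -> pres_eq w u t
| pres_cat u u' v v' :
    pres_eq w u u' -> pres_eq w v v' -> pres_eq w (u ++ v) (u' ++ v')
| pres_cancel l : pres_eq w [:: l; inv_letter l] [::]
| pres_relator : pres_eq w w [::].

Section OneRelatorGroup.
Variable w : word.

Definition pres_eqb (u v : word) : bool := `[< pres_eq w u v >].

Lemma pres_eqb_equiv : equiv_class_of pres_eqb.
Proof.
split=> [u|u v|v u t].
- exact/asboolP/pres_refl.
- by apply/asboolP/asboolP => /pres_sym.
- by move=> /asboolP uv /asboolP vt; apply/asboolP/(pres_trans uv vt).
Qed.
Canonical pres_equiv := EquivRelPack pres_eqb_equiv.

Definition pres_group := {eq_quot pres_equiv}.
HB.instance Definition _ := Choice.on pres_group.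

Definition pres_class (u : word) : pres_group := \pi_pres_group u.
Definition pres_one : pres_group := pres_class [::].
Definition pres_inv (g : pres_group) : pres_group := pres_class (inv_word (repr g)).
Definition pres_mul (g h : pres_group) : pres_group :=
  pres_class (repr g ++ repr h).

Lemma pres_classP u v : pres_eq w u v <-> pres_class u = pres_class v.
Proof.
split=> [uv|/eqmodP/asboolP //].
exact/eqmodP/asboolP.
Qed.

Lemma repr_pres_class u : pres_eq w (repr (pres_class u)) u.
Proof. by apply/pres_classP; rewrite /pres_class reprK. Qed.

Lemma pres_mul_class u v :
  pres_mul (pres_class u) (pres_class v) = pres_class (u ++ v).
Proof. by apply/pres_classP/pres_cat; apply: repr_pres_class. Qed.

Lemma inv_letterK : involutive inv_letter.
Proof. by case=> k b; rewrite /inv_letter /= negbK. Qed.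

Lemma inv_wordK : involutive inv_word.
Proof.
by move=> u; rewrite /inv_word map_rev revK -map_comp (eq_map inv_letterK) map_id.
Qed.

Lemma pres_catV u : pres_eq w (u ++ inv_word u) [::].
Proof.
elim: u => [|l u IHu]; first exact: pres_refl.
have -> : (l :: u) ++ inv_word (l :: u)
       = [:: l] ++ (u ++ inv_word u) ++ [:: inv_letter l].
  by rewrite /inv_word /= rev_cons -cats1 catA.
apply: pres_trans (pres_cancel w l).
apply: (pres_cat (pres_refl w [:: l])).
exact: pres_cat IHu (pres_refl w [:: inv_letter l]).
Qed.

Lemma pres_classK g : pres_class (repr g) = g.
Proof. exact: reprK. Qed.

Fact pres_mulA : associative pres_mul.
Proof.
move=> g h k; rewrite -(pres_classK g) -(pres_classK h) -(pres_classK k).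
by rewrite !pres_mul_class catA.
Qed.

Fact pres_mul1 : left_id pres_one pres_mul.
Proof. by move=> g; rewrite -(pres_classK g) pres_mul_class. Qed.

Fact pres_mulr1 : right_id pres_one pres_mul.
Proof. by move=> g; rewrite -(pres_classK g) pres_mul_class cats0. Qed.

Fact pres_mulV : left_inverse pres_one pres_inv pres_mul.
Proof.
move=> g; rewrite -{2}(pres_classK g) pres_mul_class; apply/pres_classP.
by rewrite -{2}[repr g]inv_wordK; exact: pres_catV.
Qed.

Fact pres_mulrV : right_inverse pres_one pres_inv pres_mul.
Proof.
move=> g; rewrite -{1}(pres_classK g) pres_mul_class; apply/pres_classP.
exact: pres_catV.
Qed.

HB.instance Definition _ := isGroup.Build pres_group
  pres_mulA pres_mul1 pres_mulr1 pres_mulV pres_mulrV.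

Definition pres_gen (k : 'I_2) : pres_group := pres_class [:: (k, false)].

End OneRelatorGroup.

Definition zexpg (G : groupType) (g : G) (k : int) : G :=
  match k with Posz n => (g ^+ n)%g | Negz n => (g ^- n.+1)%g end.

(* The relator x^p y^(-q). *)
Definition torus_relator (p q : nat) : word :=
  nseq p (ord0, false) ++ nseq q (ord_max, true).

(* G_{p,q} = < x, y | x^p = y^q > *)
Definition torus_group (p q : nat) : groupType := pres_group (torus_relator p q).
Definition tx (p q : nat) : torus_group p q := pres_gen (torus_relator p q) ord0.
Definition ty (p q : nat) : torus_group p q := pres_gen (torus_relator p q) ord_max.

Definition meridian (p q : nat) (r s : int) : torus_group p q :=
  (zexpg (tx p q) (- r) * zexpg (ty p q) s)%g.

Section Representations.
Variables (F : fieldType) (G : groupType).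

Record SL2_rep := SL2Rep {
  rep_mx :> G -> 'M[F]_2;
  rep_mx1 : rep_mx 1%g = 1%:M;
  rep_mxM : forall g h, rep_mx (g * h)%g = rep_mx g *m rep_mx h;
  rep_det : forall g, \det (rep_mx g) = 1
}.

(* Group elements act on row vectors from the right, and U stands for its row
   space, i.e. for an arbitrary subspace of F^2. *)
Definition irreducible_rep (rho : SL2_rep) : Prop :=
  forall U : 'M[F]_2, (forall g, stablemx U (rho g)) -> U = 0 \/ row_full U.

Definition conjugate_rep (rho sigma : SL2_rep) : Prop :=
  exists2 A : 'M[F]_2, \det A = 1 &
    forall g, sigma g = A *m rho g *m invmx A.

Definition conj_class (rho : SL2_rep) : set SL2_rep :=
  [set sigma | conjugate_rep rho sigma].

End Representations.

(* A complex 0 -> F^n2 -> F^n1 -> F^n0 -> 0 of based vector spaces; the boundary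
   maps d2 and d1 act on row vectors by v |-> v *m d. *)
Definition acyclic_complex (F : fieldType) (n2 n1 n0 : nat)
    (d2 : 'M[F]_(n2, n1)) (d1 : 'M[F]_(n1, n0)) : bool :=
  [&& row_free d2, (kermx d1 == d2)%MS & row_full d1].

(* The torsion \prod_i [b_i, b~_(i-1) / c_i]^((-1)^(i+1)) of such an acyclic
   complex, where c_i is the given basis, b_i a basis of the boundaries in
   degree i and b~_(i-1) a lift of b_(i-1) by d_i. Here b~_1 = c_2, so that b_1 is
   the list of rows of d2; b~_0 is the list of rows of pinvmx d1, a linear section
   of d1, and b_0 its image. The value does not depend on the lifts. *)
Definition complex_torsion (F : fieldType) (n2 n0 : nat)
    (d2 : 'M[F]_(n2, n2 + n0)) (d1 : 'M[F]_(n2 + n0, n0)) : F :=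
  let b0t := pinvmx d1 in \det (col_mx d2 b0t) / \det (b0t *m d1).

Section TwistedComplex.
Variables (F : fieldType) (w : word) (rho : SL2_rep F (pres_group w)).

(* The image under rho of the Fox derivative of u by the k-th generator:
   d(x_k)/d(x_k) = 1, d(x_k^-1)/d(x_k) = - x_k^-1, d(uv) = du + u dv. *)
Fixpoint fox_mx (k : 'I_2) (u : word) : 'M[F]_2 :=
  match u with
  | [::] => 0
  | (j, e) :: v =>
      let g := rho (pres_class w [:: (j, e)]) in
      (if j == k then (if e then - g else 1%:M) else 0) + g *m fox_mx k v
  end.

(* The cellular chain complex F^2 (x)_rho C_*(W~) of the universal cover of the
   presentation 2-complex W of < x, y | w >, which has one 0-cell, one 1-cell for
   each generator and one 2-cell attached along w. *)
Definition boundary2 : 'M[F]_(2, 2 + 2) :=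
  row_mx (fox_mx ord0 w) (fox_mx ord_max w).
Definition boundary1 : 'M[F]_(2 + 2, 2) :=
  col_mx (rho (pres_gen w ord0) - 1%:M) (rho (pres_gen w ord_max) - 1%:M).

Definition acyclic_rep : Prop := acyclic_complex boundary2 boundary1.
Definition torsion : F := complex_torsion boundary2 boundary1.

End TwistedComplex.

(* The exterior E(K_{p,q}) is simple homotopy equivalent to the presentation
   complex of < x, y | x^p = y^q >, so acyclicity and torsion of representations
   of G_{p,q} are computed from the latter. *)

(* The set of conjugacy classes of acyclic irreducible representations rho with
   tr rho(mu) = c. *)
Definition acyclic_classes (F : fieldType) (p q : nat) (r s : int) (c : F) :
    set (set (SL2_rep F (torus_group p q))) :=
  @conj_class F (torus_group p q) @`
    [set rho | [/\ irreducible_rep rho, acyclic_rep rho &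
                  \tr (rho (meridian p q r s)) = c]].

Arguments acyclic_classes {F} p q r s c.

(* The common value of the torsion on a conjugacy class. *)
Definition class_torsion (F : fieldType) (p q : nat)
    (X : set (SL2_rep F (torus_group p q))) : F :=
  xget 0 [set t | exists2 rho, X rho & t = torsion rho].

(* \sum_(l = - floor(m/n))^(floor(m/n)) (-1)^((n+1)l) binomial(2m, m + nl), with
   l = i - floor(m/n); the argument of the absolute value is nonnegative. *)
Definition binomial_sum (F : fieldType) (n m : nat) : F :=
  \sum_(i < (m %/ n).*2.+1)
     let l : int := i%:Z - (m %/ n)%:Z in
     (-1) ^ (n.+1%:Z * l) * ('C(m.*2, absz (m%:Z + n%:Z * l)))%:R.

(* (n / 2^(m+1)) binomial_sum n m - 2^(m-1) eps_n *)
Definition torus_factor (F : fieldType) (n m : nat) : F :=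
  n%:R / 2 ^+ m.+1 * binomial_sum F n m - 2 ^ (m%:Z - 1) * (n %% 2)%:R.

(* Main.v *)
(** Writing X and Y for the images of x and y, irreducibility makes X^p = Y^q
    a scalar, which is 1 or -1. If it is 1, the Fox derivatives of the relator
    vanish; if it is -1, the complex is acyclic and the Fox identity
    (dw/dx) (X - 1) = X^p - 1 gives the torsion 4 / (det (X - 1) det (Y - 1)).
    An eigenvector v of X gives the basis (v, v Y), in which X and Y only depend
    on an eigenvalue of X, tr Y and tr (X Y); since tr rho(mu) is an affine
    function of tr (X Y) with nonzero slope, the acyclic classes with
    tr rho(mu) = c correspond to the pairs of odd (a, b). With z = exp(i pi / p),
    the inverse torsion is the product of (2 - z^a - z^-a) / 2 and its analogue
    for q; expanding (2 - z^a - z^-a)^m binomially and summing over all odd a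
    modulo 2p leaves the binomials C(2m, m + pl). *)
Require Import Defs.
From mathcomp Require Import all_boot all_order all_algebra.
From mathcomp Require Import all_classical all_reals all_analysis.
From mathcomp Require Import complex.
From mathcomp Require Import ring zify.

Set Implicit Arguments.
Unset Strict Implicit.
Unset Printing Implicit Defensive.

Import Order.TTheory GRing.Theory Num.Theory.
Local Open Scope classical_set_scope.
Local Open Scope ring_scope.
Local Open Scope complex_scope.

Lemma ord2_ind (P : 'I_2 -> Prop) : P 0 -> P 1 -> forall i, P i.
Proof.
move=> P0 P1 [[|[|k]] ltk2] //.
  by rewrite (_ : Ordinal _ = 0) //; apply: val_inj.
by rewrite (_ : Ordinal _ = 1) //; apply: val_inj.
Qed.

Lemma ord2_max : 1 = ord_max :> 'I_2.
Proof. exact: val_inj. Qed.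

(** * Two by two matrices *)

Section TwoByTwo.
Variable F : fieldType.
Implicit Types (A B X Y P U : 'M[F]_2) (a t z lam : F).

Lemma mx2_eq A B :
  A 0 0 = B 0 0 -> A 0 1 = B 0 1 -> A 1 0 = B 1 0 -> A 1 1 = B 1 1 -> A = B.
Proof.
by move=> *; apply/matrixP; elim/ord2_ind; elim/ord2_ind.
Qed.

Lemma mulmx2E m n (A : 'M[F]_(m, 2)) (B : 'M[F]_(2, n)) i j :
  (A *m B) i j = A i 0 * B 0 j + A i 1 * B 1 j.
Proof.
rewrite mxE 2!big_ord_recl big_ord0 addr0.
by congr (_ * _ + A i _ * B _ _); apply: val_inj.
Qed.

Lemma det2E A : \det A = A 0 0 * A 1 1 - A 0 1 * A 1 0.
Proof.
rewrite (expand_det_row _ 0) 2!big_ord_recl big_ord0 addr0 /cofactor.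
rewrite !det_mx11 !mxE /= expr0 expr1 mul1r mulN1r mulrN.
by congr (A _ _ * A _ _ - A _ _ * A _ _); apply: val_inj.
Qed.

Lemma tr2E A : \tr A = A 0 0 + A 1 1.
Proof.
by rewrite /mxtrace 2!big_ord_recl big_ord0 addr0; congr (_ + A _ _); apply: val_inj.
Qed.

Definition mx2E := (det2E, tr2E, mulmx2E).

Ltac mx2 := apply: mx2_eq; rewrite -?mulmxE !(mx2E, mxE) /=.

Lemma Cayley_Hamilton2 A : A *m A = \tr A *: A - (\det A)%:M.
Proof. by mx2; ring. Qed.

Lemma det_sub_scalar2 A z : \det (A - z%:M) = z ^+ 2 - \tr A * z + \det A.
Proof. by rewrite !(mx2E, mxE) /=; ring. Qed.

Lemma SL2_det_sub1 A : \det A = 1 -> \det (A - 1%:M) = 2 - \tr A.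
Proof. by move=> dA; rewrite det_sub_scalar2 dA; ring. Qed.

Lemma SL2_unit A : \det A = 1 -> A \is a GRing.unit.
Proof. by move=> dA; rewrite -[_ \is a _]/(A \in unitmx) unitmxE dA unitr1. Qed.

Lemma SL2_inv A : \det A = 1 -> A^-1 = (\tr A)%:M - A.
Proof.
move=> dA; apply: (mulrI (SL2_unit dA)); rewrite mulrV ?SL2_unit //.
by rewrite -mulmxE mulmxBr Cayley_Hamilton2 dA mul_mx_scalar opprB addrC addrNK.
Qed.

Lemma expz_eigen A P lam (n : int) :
  A \is a GRing.unit -> lam != 0 -> A *m P = lam *: P ->
  A ^ n *m P = lam ^ n *: P.
Proof.
move=> uA lam0 AP.
have nat_case k : A ^+ k *m P = lam ^+ k *: P.
  elim: k => [|k IHk]; first by rewrite !expr0 scale1r mul1mx.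
  by rewrite exprS -mulmxE -mulmxA IHk -scalemxAr AP scalerA -exprSr.
case: n => k; first exact: nat_case.
rewrite NegzE -!exprz_inv -!exprnP !exprVn.
have [uk lk] : A ^+ k.+1 \is a GRing.unit /\ lam ^+ k.+1 != 0.
  by rewrite unitrX // expf_neq0.
apply: (can_inj (mulKmx uk)); rewrite mulmxA mulmxE mulrV // mul1r.
by rewrite -mulmxE -scalemxAr nat_case scalerA mulVf // scale1r.
Qed.

(** By Cayley-Hamilton, the columns of [A - lam^-1] and [A - lam] lie in the eigenspaces for [lam]
    and [lam^-1], and these two matrices differ by [lam - lam^-1]. Keeping that factor on the left
    avoids a division and any case distinction at [lam = 1] or [-1]. *)
Lemma expz_SL2 A lam (n : int) : \det A = 1 -> lam != 0 ->
    \tr A = lam + lam^-1 ->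
  (lam - lam^-1) *: A ^ n =
    lam ^ n *: (A - lam^-1%:M) - lam ^ (- n) *: (A - lam%:M).
Proof.
move=> dA lam0 tA; have uA := SL2_unit dA.
have P x y : x * y = 1 -> \tr A = x + y -> A *m (A - y%:M) = x *: (A - y%:M).
  move=> xy tAxy; rewrite mulmxBr Cayley_Hamilton2 dA -xy tAxy mul_mx_scalar.
  by apply/matrixP=> i j; rewrite !mxE; ring.
have P1 := P _ _ (mulfV lam0) tA.
have P2 : A *m (A - lam%:M) = lam^-1 *: (A - lam%:M).
  by apply: P; rewrite ?mulVf // addrC.
have -> : lam ^ (- n) = lam^-1 ^ n by rewrite exprz_inv.
rewrite -(expz_eigen n uA lam0 P1) -(expz_eigen n uA _ P2) ?invr_eq0 //.
rewrite -mulmxBr -mul_mx_scalar; congr (_ *m _).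
by apply/matrixP=> i j; rewrite !mxE; ring.
Qed.

(* A stable line would be a common eigenspace, hence killed by the commutator. *)
Lemma irreducible_commutator X Y U :
    \det (X *m Y - Y *m X) != 0 -> stablemx U X -> stablemx U Y ->
  U = 0 \/ row_full U.
Proof.
move=> dXY UX UY; case: (eqVneq U 0) => [|U0]; [by left | right].
rewrite /row_full; have := rank_leq_col U; rewrite leq_eqVlt => /orP[//|].
rewrite ltnS leq_eqVlt ltnS leqn0 mxrank_eq0 (negPf U0) orbF => /eqP rU.
have /rowV0Pn[v vU v0] := U0.
have eq_vU : (v :=: U)%MS.
  by apply/eqmxP; rewrite -(mxrank_leqif_eq vU) rU rank_rV v0.
have eigen Z : stablemx U Z -> exists a, v *m Z = a *: v.
  move=> UZ; apply/sub_rVP; rewrite eq_vU.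
  exact: submx_trans (submxMr _ vU) UZ.
have [[a vX] [b vY]] := (eigen _ UX, eigen _ UY).
suff : v *m (X *m Y - Y *m X) = 0.
  have uXY : X *m Y - Y *m X \in unitmx by rewrite unitmxE unitfE.
  by rewrite -(mul0mx _ (X *m Y - Y *m X)) => /(can_inj (mulmxK uXY))/eqP/(negP v0).
rewrite mulmxBr !mulmxA vX vY -!scalemxAl vX vY !scalerA mulrC subrr //.
Qed.

Lemma row_basis2 (v w : 'rV[F]_2) :
  v != 0 -> ~~ (w <= v)%MS -> (col_mx v w : 'M[F]_2) \in unitmx.
Proof.
move=> v0 wv; rewrite -row_full_unit /row_full eqn_leq rank_leq_col /=.
have vsub : (v <= col_mx v w)%MS by rewrite -addsmxE addsmxSl.
have := (mxrank_leqif_sup vsub); rewrite rank_rV v0 /= => -[le1 eq1].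
by rewrite ltn_neqAle le1 eq1 col_mx_sub submx_refl /= wv.
Qed.

(* Here (A - lam)^2 = 0, so A^n = lam^n + n lam^(n-1) (A - lam). *)
Lemma SL2_scalar_of_expr A lam z n : (0 < n)%N -> n%:R != 0 :> F ->
    \det A = 1 -> \tr A = lam + lam^-1 -> lam != 0 -> lam ^+ 2 = 1 ->
  A ^+ n = z%:M -> A = lam%:M.
Proof.
move=> n0 nF dA tA lam0 lam2.
have lamV : lam^-1 = lam by apply: (mulfI lam0); rewrite mulfV // -expr2 lam2.
pose N := A - lam%:M.
have NN : N * N = 0.
  rewrite -mulmxE mulmxBr mulmxBl Cayley_Hamilton2 dA tA lamV -lam2.
  by rewrite mul_mx_scalar mul_scalar_mx; apply/matrixP=> i j; rewrite !mxE; ring.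
have pow k : A ^+ k.+1 = lam ^+ k.+1 *: 1 + (k.+1%:R * lam ^+ k) *: N.
  elim: k => [|k IHk]; first by rewrite !expr1 expr0 mulr1 scale1r scalemx1 addrC subrK.
  rewrite exprS IHk -[A in A * _](subrK lam%:M) -/N mulrDl !mulrDr -!scalerAr NN
    scaler0 !mulr1 addr0.
  rewrite -!mulmxE !mul_scalar_mx -[lam%:M]scalemx1; apply/matrixP=> i j; rewrite !mxE.
  by rewrite [k.+2%:R]mulrSr ![lam ^+ _.+1]exprS; ring.
case: n n0 nF => // n _ nF; rewrite pow => Az.
have c0 : n.+1%:R * lam ^+ n != 0 by rewrite mulf_neq0 // expf_neq0.
have Ns : N = ((n.+1%:R * lam ^+ n)^-1 * (z - lam ^+ n.+1))%:M.
  apply: (scalerI c0); rewrite scale_scalar_mx mulVKf //.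
  apply: (addrI (lam ^+ n.+1 *: 1)); rewrite Az.
  by apply/matrixP=> i j; rewrite !mxE mulr_natr -mulrnDl addrC subrK.
move: NN; rewrite Ns -mulmxE -scalar_mxM => /matrixP/(_ 0 0)/eqP.
rewrite !mxE mulr1n mulf_eq0 orbb => /eqP d0; apply/eqP; rewrite -subr_eq0 -/N Ns d0.
by rewrite raddf0.
Qed.
End TwoByTwo.

(** * Representations of a one-relator group *)

Section PresentedGroupReps.
Variables (F : fieldType) (w : word).
Implicit Types (rho sigma : SL2_rep F (pres_group w)) (A U Z : 'M[F]_2).

Lemma pres_group_ind (P : pres_group w -> Prop) :
    P 1%g -> (forall k, P (pres_gen w k)) -> (forall g, P g -> P g^-1%g) ->
    (forall g h, P g -> P h -> P (g * h)%g) -> forall g, P g.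
Proof.
move=> P1 Pgen PV PM g; rewrite -(pres_classK g).
elim: (repr g) => [|[k e] u IHu]; first exact: P1.
rewrite -cat1s -pres_mul_class; apply: PM IHu.
case: e; last exact: Pgen.
suff -> : pres_class w [:: (k, true)] = (pres_gen w k)^-1%g.
  exact/PV/Pgen.
apply: (mulIg (pres_gen w k)); rewrite mulVg [LHS]pres_mul_class.
exact/pres_classP/(pres_cancel w (k, true)).
Qed.

Lemma repM rho g h : rho (g * h)%g = rho g * rho h.
Proof. exact: rep_mxM. Qed.

Lemma rep1 rho : rho 1%g = 1.
Proof. exact: rep_mx1. Qed.

Lemma rep_unit rho g : rho g \is a GRing.unit.
Proof. exact: SL2_unit (rep_det rho g). Qed.

Lemma repV rho g : rho g^-1%g = (rho g)^-1.
Proof.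
by apply: (mulrI (rep_unit rho g)); rewrite -repM mulgV rep1 mulrV ?rep_unit.
Qed.

Lemma repX rho g n : rho (g ^+ n)%g = rho g ^+ n.
Proof. by elim: n => [|n IHn]; rewrite ?rep1 // expgS exprS repM IHn. Qed.

Lemma rep_zexpg rho g k : rho (zexpg g k) = rho g ^ k.
Proof. by case: k => n; rewrite /zexpg ?NegzE ?repV repX. Qed.

Lemma rep_cat rho u v :
  rho (pres_class w (u ++ v)) = rho (pres_class w u) * rho (pres_class w v).
Proof. by rewrite -repM [X in _ = rho X]pres_mul_class. Qed.

Lemma rep_conj_gen rho sigma A : A \in unitmx ->
    (forall k, sigma (pres_gen w k) *m A = A *m rho (pres_gen w k)) ->
  forall g, sigma g *m A = A *m rho g.
Proof.
move=> uA gens; apply: pres_group_ind => [|//|g IHg|g h IHg IHh].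
- by rewrite !rep_mx1 mul1mx mulmx1.
- rewrite !repV; rewrite !mulmxE in IHg *.
  apply: (mulrI (rep_unit sigma g)); apply: (mulIr (rep_unit rho g)).
  by rewrite !mulrA mulrV ?rep_unit // mul1r divrK ?rep_unit.
- by rewrite !rep_mxM -mulmxA IHh !mulmxA IHg.
Qed.

Lemma stablemx_gen rho U : (forall k, stablemx U (rho (pres_gen w k))) ->
  forall g, stablemx U (rho g).
Proof.
move=> gens; apply: pres_group_ind => [|//|g IHg|g h IHg IHh].
- by rewrite rep_mx1 stablemxC.
(* In determinant 1 the inverse is the trace minus the matrix, so stability passes to inverses. *)
- by rewrite repV SL2_inv ?rep_det // stablemxD ?stablemxC ?stablemxN.
- by rewrite rep_mxM stablemxM.
Qed.

Lemma irreducible_conj rho sigma :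
  conjugate_rep rho sigma -> irreducible_rep rho -> irreducible_rep sigma.
Proof.
move=> [A dA conj] irr U stabU; have uA : A \in unitmx by rewrite unitmxE dA unitr1.
have stabUA g : stablemx (U *m A) (rho g).
  have -> : stablemx (U *m A) (rho g) = (U *m sigma g *m A <= U *m A)%MS.
    by rewrite conj !mulmxA mulmxKV.
  exact/submxMr/stabU.
case: (irr _ stabUA) => [UA0|fullUA].
  by left; rewrite -(mulmxK uA U) UA0 mul0mx.
by right; rewrite /row_full -(mxrankMfree U (B := A)) ?row_free_unit.
Qed.

(** Dividing [A] by a square root of its determinant gives determinant 1, as [conjugate_rep]
    requires. *)
Lemma conjugate_repW rho sigma A : A \in unitmx -> (exists a, a ^+ 2 = \det A) ->
    (forall g, sigma g *m A = A *m rho g) -> conjugate_rep rho sigma.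
Proof.
move=> uA [a a2] conj.
have a0 : a != 0 by apply: contraTneq uA => a0; rewrite unitmxE -a2 a0 expr0n unitr0.
have ua : a^-1 \is a GRing.unit by rewrite unitfE invr_eq0.
exists (a^-1 *: A) => [|g].
  by rewrite detZ -a2 exprVn mulVf // expf_neq0.
by rewrite invmxZ ?unitmxZ // -scalemxAl -scalemxAr -scalemxAl scalerA mulVf
  ?invr_eq0 // scale1r -conj mulmxK.
Qed.

(** The eigenspace is nonzero and stable under the generators, hence everything. The eigenvalue is a
    hypothesis because [F] need not be algebraically closed. *)
Lemma schur rho Z z : irreducible_rep rho -> eigenvalue Z z ->
    (forall k, comm_mx Z (rho (pres_gen w k))) -> Z = z%:M.
Proof.
move=> irr eigz commZ.
have stab : forall g, stablemx (eigenspace Z z) (rho g).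
  by apply: stablemx_gen => k; apply: comm_mx_stable_eigenspace.
case: (irr _ stab) => [e0|full]; first by rewrite /eigenvalue e0 eqxx in eigz.
apply/eqP; rewrite -subr_eq0; apply/eqP; rewrite -[LHS]mul1mx.
by apply/sub_kermxP; apply: submx_full.
Qed.

Lemma irreducible_gen rho (v : 'rV[F]_2) a b : irreducible_rep rho -> v != 0 ->
  v *m rho (pres_gen w ord0) = a *: v ->
  v *m rho (pres_gen w ord_max) = b *: v -> False.
Proof.
move=> irr v0 v1 v2.
have stab : forall g, stablemx <<v>>%MS (rho g).
  apply: stablemx_gen; elim/ord2_ind;
    rewrite ?ord2_max (eqmxMr _ (genmxE v)) genmxE ?v1 ?v2; exact: scalemx_sub.
case: (irr _ stab) => [e0|].
  by move: v0; rewrite -mxrank_eq0 -(genmxE v) e0 mxrank0.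
by rewrite /row_full genmxE rank_rV v0.
Qed.

Definition letter_mx (M : 'I_2 -> 'M[F]_2) (l : letter) :=
  if l.2 then (M l.1)^-1 else M l.1.
Definition word_mx M (u : word) := \prod_(l <- u) letter_mx M l.

Section Build.
Variable M : 'I_2 -> 'M[F]_2.
Hypotheses (detM : forall k, \det (M k) = 1) (relM : word_mx M w = 1).

(** Von Dyck's argument: each rule generating [pres_eq] preserves the product once the relator is
    sent to 1. *)
Lemma word_mx_pres u v : pres_eq w u v -> word_mx M u = word_mx M v.
Proof.
elim=> // [v' u' t _ -> _ -> //|u1 u2 v1 v2 _ IHu _ IHv|[k e]|]; last first.
- by rewrite relM /word_mx big_nil.
- have uM := SL2_unit (detM k).
  rewrite /word_mx !(big_cons, big_nil) mulr1 /letter_mx /=.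
  by case: e; rewrite /= (mulrV uM, mulVr uM).
- by rewrite /word_mx !big_cat; congr (_ * _).
Qed.

Lemma word_mx_det u : \det (word_mx M u) = 1.
Proof.
rewrite /word_mx; elim/big_ind: _ => [|A B dA dB|[k e] _]; first exact: det1.
  by rewrite det_mulmx dA dB mulr1.
rewrite /letter_mx /=; case: e => //.
by rewrite -[_^-1]/(invmx _) det_inv detM invr1.
Qed.

Definition word_rep : SL2_rep F (pres_group w).
Proof.
exists (fun g => word_mx M (repr g)) => [|g h|g]; last exact: word_mx_det.
- by rewrite (word_mx_pres (repr_pres_class _ _)) /word_mx big_nil.
- by rewrite (word_mx_pres (repr_pres_class _ _)) /word_mx big_cat.
Defined.

Lemma word_rep_gen k : word_rep (pres_gen w k) = M k.
Proof.
by rewrite [LHS](word_mx_pres (repr_pres_class _ _)) /word_mx big_seq1.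
Qed.
End Build.
End PresentedGroupReps.

(** * Acyclicity and torsion *)

Section TorusComplex.
Variable F : fieldType.

Section TwoGenerators.
Variables (n : nat) (f0 f1 A B : 'M[F]_n) (a : F).
Hypotheses (a0 : a != 0) (f0A : f0 *m A = a%:M) (f1B : f1 *m B = (- a)%:M).

Let d2 : 'M[F]_(n, n + n) := row_mx f0 f1.
Let d1 : 'M[F]_(n + n, n) := col_mx A B.

Let A_full : row_full d1.
Proof.
apply/row_fullP; exists (row_mx (a^-1 *: f0) 0).
by rewrite mul_row_col mul0mx addr0 -scalemxAl f0A scale_scalar_mx mulVf.
Qed.

Let d2_free : row_free d2.
Proof.
apply/row_freeP; exists (col_mx (a^-1 *: A) 0).
by rewrite mul_row_col mulmx0 addr0 -scalemxAr f0A scale_scalar_mx mulVf.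
Qed.

Let d2d1 : d2 *m d1 = 0.
Proof. by rewrite mul_row_col f0A f1B -raddfD subrr raddf0. Qed.

(** The relation [f0 A = a] provides explicit one-sided inverses of both boundary maps; exactness in
    the middle is then the rank count [2n - n = n]. *)
Lemma acyclic_two_generators : acyclic_complex d2 d1.
Proof.
rewrite /acyclic_complex d2_free A_full andbT /=.
have sub : (d2 <= kermx d1)%MS by apply/sub_kermxP.
rewrite andbC sub /= -(mxrank_leqif_sup sub) mxrank_ker.
by rewrite (eqP d2_free) (eqP A_full) addnK.
Qed.

(** Multiplying the basis matrix by the block matrix with rows [(1, A)] and [(0, B)] makes it block
    lower triangular with determinant [det f0]. So the torsion is [det f0 / det B], and
    [det f0 = a^n / det A]. *)
Lemma torsion_two_generators :
  complex_torsion d2 d1 = a ^+ n / (\det A * \det B).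
Proof.
have bd1 := mulVpmx A_full.
rewrite /complex_torsion bd1 det1 divr1.
set M := col_mx _ _; pose N : 'M[F]_(n + n) := block_mx 1%:M A 0 B.
have detN : \det N = \det B by rewrite det_ublock det1 mul1r.
have MN : M *m N = block_mx f0 0 (pinvmx d1 *m col_mx 1%:M 0) 1%:M.
  rewrite (_ : N = row_mx (col_mx 1%:M 0) d1); last by rewrite /N block_mxEh.
  rewrite mul_col_mx !mul_mx_row d2d1 bd1 mul_row_col mulmx1 mulmx0 addr0.
  by [].
have := congr1 determinant MN; rewrite det_mulmx detN det_lblock det1 mulr1.
have := congr1 determinant f0A; rewrite det_mulmx det_scalar => <- <-.
have neq0 (x : F) (C D : 'M[F]_n) : x != 0 -> C *m D = x%:M -> \det D != 0.
  move=> x0 /(congr1 determinant); rewrite det_mulmx det_scalar => CD.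
  by have := expf_neq0 n x0; rewrite -CD mulf_eq0 negb_or => /andP[].
have A0 := neq0 _ _ _ a0 f0A.
have B0 : \det B != 0 by apply: neq0 f1B; rewrite oppr_eq0.
by field; rewrite A0 B0.
Qed.
End TwoGenerators.

(** * Fox calculus of the torus relator *)

Section TorusRep.
Variables p q : nat.
Implicit Types rho : SL2_rep F (torus_group p q).

Lemma rep_nseq rho l n :
  rho (pres_class _ (nseq n l)) = rho (pres_class _ [:: l]) ^+ n.
Proof.
elim: n => [|n IHn]; first by rewrite expr0; exact: rep1.
by rewrite exprS -IHn -rep_cat.
Qed.

Lemma rep_letterV rho k :
  rho (pres_class _ [:: (k, true)]) = (rho (pres_gen _ k))^-1.
Proof.
apply: (mulIr (rep_unit rho (pres_gen _ k))); rewrite mulVr ?rep_unit //.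
rewrite -[RHS](rep1 rho) -[X in _ * rho X]/(pres_class _ [:: (k, false)]) -rep_cat;
  congr (rho _).
exact/pres_classP/(pres_cancel _ (k, true)).
Qed.

Lemma torus_relation rho : rho (tx p q) ^+ p = rho (ty p q) ^+ q.
Proof.
have : rho (pres_class _ (torus_relator p q)) = 1.
  by rewrite -(rep1 rho); congr (rho _); exact/pres_classP/pres_relator.
rewrite rep_cat !rep_nseq rep_letterV exprVn.
by move/(congr1 ( *%R^~ (rho (ty p q) ^+ q))); rewrite mul1r divrK // unitrX ?rep_unit.
Qed.

Lemma fox_cat rho k u v :
  fox_mx rho k (u ++ v) =
    fox_mx rho k u + rho (pres_class _ u) *m fox_mx rho k v.
Proof.
elim: u => [|[j e] u IHu] /=.
  by rewrite add0r [X in X *m _](rep1 rho) mul1mx.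
by rewrite IHu mulmxDr addrA mulmxA (rep_cat rho [:: (j, e)] u).
Qed.

Lemma fox_nseq_neq rho k j e n : j != k -> fox_mx rho k (nseq n (j, e)) = 0.
Proof.
by move=> jk; elim: n => //= n ->; rewrite (negPf jk) mulmx0 addr0.
Qed.

Lemma fox_nseq rho k e n :
  fox_mx rho k (nseq n (k, e)) *m (rho (pres_gen _ k) - 1%:M) =
    rho (pres_class _ [:: (k, e)]) ^+ n - 1.
Proof.
elim: n => [|n IHn] /=; first by rewrite mul0mx expr0 subrr.
set g := rho (pres_class _ [:: (k, e)]); set h := rho (pres_gen _ k).
have step : (if e then - g else 1) * (h - 1) = g - 1.
  rewrite /g; case: e {IHn g}; last by rewrite mul1r.
  by rewrite rep_letterV mulNr mulrBr mulVr ?rep_unit // mulr1 opprB.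
rewrite eqxx mulmxDl -mulmxA IHn exprS [X in X + _]step mulmxE mulrBr mulr1.
by rewrite addrC addrA subrK.
Qed.

Lemma fox_torus_x rho :
  fox_mx rho ord0 (torus_relator p q) *m (rho (tx p q) - 1%:M) = rho (tx p q) ^+ p - 1.
Proof.
rewrite fox_cat (fox_nseq_neq rho (k := ord0) (j := ord_max)) // mulmx0 addr0.
exact: fox_nseq.
Qed.

(** The prefix [x^p] of the relator multiplies [Y^-q - 1], and [X^p Y^-q = 1]. *)
Lemma fox_torus_y rho :
  fox_mx rho ord_max (torus_relator p q) *m (rho (ty p q) - 1%:M) =
    1 - rho (tx p q) ^+ p.
Proof.
rewrite fox_cat (fox_nseq_neq rho (k := ord_max) (j := ord0)) // add0r -mulmxA.
rewrite [X in _ *m X]fox_nseq rep_letterV rep_nseq mulmxE mulrBr mulr1; congr (_ - _).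
by rewrite torus_relation exprVn mulrV // unitrX ?rep_unit.
Qed.

Lemma boundary1_torus rho :
  boundary1 rho = col_mx (rho (tx p q) - 1%:M) (rho (ty p q) - 1%:M).
Proof. by []. Qed.

Hypothesis two0 : 2%:R != 0 :> F.

(** The Fox identities have the scalar right-hand sides -2 and 2, so the two-generator computation
    applies with [a = -2]; the 4 is its square. *)
Lemma torus_acyclic_torsion rho : rho (tx p q) ^+ p = -1 ->
  acyclic_rep rho /\
  torsion rho = 4 / ((2 - \tr (rho (tx p q))) * (2 - \tr (rho (ty p q)))).
Proof.
move=> Xp; have fx := fox_torus_x rho; have fy := fox_torus_y rho.
have c0 : - 2%:R != 0 :> F by rewrite oppr_eq0.
have E1 : -1 - 1 = (- 2%:R)%:M :> 'M[F]_2.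
  by apply/matrixP=> i j; rewrite !mxE; ring.
have E2 : 1 - -1 = (- - 2%:R)%:M :> 'M[F]_2.
  by apply/matrixP=> i j; rewrite !mxE; ring.
rewrite Xp E1 in fx; rewrite Xp E2 in fy.
rewrite /acyclic_rep /torsion /boundary2 boundary1_torus; split.
  exact: (acyclic_two_generators c0 fx fy).
rewrite (torsion_two_generators c0 fx fy) !SL2_det_sub1 ?rep_det //.
by congr (_ / _); ring.
Qed.

(** The traces differ from 2, so [X - 1] and [Y - 1] are invertible and the Fox identities force
    both derivatives to vanish; the zero map [boundary2] is not injective. *)
Lemma torus_not_acyclic rho : rho (tx p q) ^+ p = 1 ->
  \tr (rho (tx p q)) != 2 -> \tr (rho (ty p q)) != 2 -> ~ acyclic_rep rho.
Proof.
move=> Xp tX tY; have fx := fox_torus_x rho; have fy := fox_torus_y rho.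
rewrite Xp subrr in fx fy.
have unit1 (A : 'M[F]_2) : \det A = 1 -> \tr A != 2 -> A - 1%:M \in unitmx.
  by move=> dA tA; rewrite unitmxE SL2_det_sub1 // unitfE subr_eq0 eq_sym.
have zero (f A : 'M[F]_2) : A \in unitmx -> f *m A = 0 -> f = 0.
  by move=> uA fA; rewrite -(mulmxK uA f) fA mul0mx.
rewrite /acyclic_rep /acyclic_complex /boundary2.
rewrite (zero _ _ (unit1 _ (rep_det _ _) tX) fx).
rewrite (zero _ _ (unit1 _ (rep_det _ _) tY) fy).
by rewrite row_mx0 /row_free mxrank0.
Qed.

End TorusRep.
End TorusComplex.

(** * Classification by traces *)

Section NormalForm.
Variable F : fieldType.
Implicit Types (X Y : 'M[F]_2) (v w : 'rV[F]_2) (lam nu : F).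

Definition mx2 (a b c d : F) : 'M[F]_2 :=
  \matrix_(i, j) if i == 0 then if j == 0 then a else b
                 else if j == 0 then c else d.

Lemma mx2_mul_col (a b c d : F) v w :
  mx2 a b c d *m col_mx v w = col_mx (a *: v + b *: w) (c *: v + d *: w).
Proof.
have up (v1 w1 : 'rV[F]_2) j : col_mx v1 w1 (0 : 'I_2) j = v1 0 j.
  by rewrite -(col_mxEu v1 w1 0 j); congr (col_mx _ _ _ _); apply: val_inj.
have down (v1 w1 : 'rV[F]_2) j : col_mx v1 w1 (1 : 'I_2) j = w1 0 j.
  by rewrite -(col_mxEd v1 w1 0 j); congr (col_mx _ _ _ _); apply: val_inj.
by apply/matrixP; elim/ord2_ind => j; rewrite !mulmx2E ?up ?down !mxE.
Qed.

(** The adjugate of a 2 by 2 matrix is its trace minus the matrix; this is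
    [adj X adj Y = adj (Y X)]. *)
Lemma adjM2 X Y :
  ((\tr X)%:M - X) *m ((\tr Y)%:M - Y) = (\tr (X *m Y))%:M - Y *m X.
Proof. by apply: mx2_eq; rewrite !(mx2E, mxE) /=; ring. Qed.

Lemma normal_form2 X Y v lam : v != 0 -> v *m X = lam *: v ->
    \tr X = lam + lam^-1 -> ~~ (v *m Y <= v)%MS -> \det Y = 1 ->
  exists2 B : 'M[F]_2, B \in unitmx &
    B *m X = mx2 lam 0 (\tr (X *m Y) - lam^-1 * \tr Y) lam^-1 *m B /\
    B *m Y = mx2 0 1 (-1) (\tr Y) *m B.
Proof.
move=> v0 vX tX vY dY; exists (col_mx v (v *m Y)); first exact: row_basis2.
have vXV : v *m ((\tr X)%:M - X) = lam^-1 *: v.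
  by rewrite mulmxBr mul_mx_scalar vX tX scalerDl addrAC subrr add0r.
(* Since [v adj X = lam^-1 v], applying [v] to [adjM2] expresses [v Y X] in the basis [v], [v Y]. *)
have vYX : v *m Y *m X =
    (\tr (X *m Y) - lam^-1 * \tr Y) *: v + lam^-1 *: (v *m Y).
  have /(congr1 (mulmx v)) := adjM2 X Y.
  rewrite mulmxA vXV -scalemxAl !mulmxBr !mul_mx_scalar mulmxA scalerBr scalerA.
  move/(canRL (subrK _)); rewrite addrC => /(canLR (addrK _)) <-.
  by rewrite scalerBl; apply/matrixP=> i j; rewrite !mxE; ring.
have vYY : v *m Y *m Y = - 1 *: v + \tr Y *: (v *m Y).
  by rewrite -mulmxA Cayley_Hamilton2 dY mulmxBr mulmx1 -scalemxAr addrC scaleN1r.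
by split; rewrite mx2_mul_col (@mul_col_mx _ 1 1) ?vX ?vYX ?vYY ?scale0r ?addr0
  ?add0r ?scale1r.
Qed.

Lemma eigenvalue2 X lam : \det X = 1 -> eigenvalue X lam ->
  lam != 0 /\ \tr X = lam + lam^-1.
Proof.
move=> dX; rewrite /eigenvalue /eigenspace kermx_eq0 row_free_unit unitmxE unitfE.
rewrite negbK det_sub_scalar2 dX => /eqP e.
have lam0 : lam != 0.
  by apply: contra_eq_neq e => ->; rewrite expr0n mulr0 subr0 add0r oner_eq0.
split=> //; apply: (mulIf lam0); rewrite mulrDl mulVf // -expr2.
by apply/eqP; rewrite -subr_eq0 -oppr_eq0 -e; apply/eqP; ring.
Qed.

Lemma eigenvalue_trace X lam : \det X = 1 -> lam != 0 ->
  \tr X = lam + lam^-1 -> eigenvalue X lam.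
Proof.
move=> dX lam0 tX; rewrite /eigenvalue /eigenspace kermx_eq0 row_free_unit.
rewrite unitmxE unitfE negbK det_sub_scalar2 dX tX.
by apply/eqP; field.
Qed.

Lemma sub_inv_neq0 (a : F) : a != 0 -> a ^+ 2 != 1 -> a - a^-1 != 0.
Proof.
move=> a0; apply: contra; rewrite subr_eq0 => /eqP e.
by rewrite expr2 {2}e mulfV.
Qed.

Lemma SL2_expN1 X lam n : \det X = 1 -> \tr X = lam + lam^-1 ->
  lam != 0 -> lam ^+ 2 != 1 -> lam ^+ n = -1 -> X ^+ n = -1.
Proof.
move=> dX tX lam0 lam2 lamn.
apply: (scalerI (sub_inv_neq0 lam0 lam2));
  rewrite [X ^+ n]exprnP expz_SL2 // -exprnN -!exprnP lamn invrN1.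
by rewrite !scaleN1r; apply/matrixP=> i j; rewrite !mxE; ring.
Qed.

Lemma row_mulX (v : 'rV[F]_2) X lam n : v *m X = lam *: v ->
  v *m X ^+ n = lam ^+ n *: v.
Proof.
move=> vX; elim: n => [|n IHn]; first by rewrite !expr0 scale1r [LHS]mulmx1.
by rewrite exprSr -mulmxE mulmxA IHn -scalemxAl vX scalerA -exprSr.
Qed.

End NormalForm.

Section Classification.
Variable C : numClosedFieldType.

(** Equal traces give [x] a common eigenvalue [lam] under both representations, so both have the
    same normal form, and the two base changes compose to a conjugation. Irreducibility keeps the
    chosen eigenvector of [x] from being one of [y]. *)
Lemma irreducible_conjugate w (rho sigma : SL2_rep C (pres_group w)) :
    let x := pres_gen w ord0 in let y := pres_gen w ord_max in
    irreducible_rep rho -> irreducible_rep sigma ->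
    \tr (rho x) = \tr (sigma x) -> \tr (rho y) = \tr (sigma y) ->
    \tr (rho x *m rho y) = \tr (sigma x *m sigma y) ->
  conjugate_rep rho sigma.
Proof.
move=> x y irr_rho irr_sigma tx ty txy.
have [lam eig] := eigenvalue_closed (rho x) (isT : 0 < 2)%N.
have [lam0 tlam] := eigenvalue2 (rep_det rho x) eig.
have nf tau : irreducible_rep tau -> \tr (tau x) = lam + lam^-1 ->
    exists2 B : 'M[C]_2, B \in unitmx &
      B *m tau x =
        mx2 lam 0 (\tr (tau x *m tau y) - lam^-1 * \tr (tau y)) lam^-1 *m B /\
      B *m tau y = mx2 0 1 (-1) (\tr (tau y)) *m B.
  move=> irr ttau.
  have /eigenvalueP[v vx v0] := eigenvalue_trace (rep_det tau x) lam0 ttau.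
  apply: (normal_form2 v0 vx ttau) (rep_det tau y).
  by apply/negP=> /sub_rVP[b vy]; exact: irreducible_gen irr v0 vx vy.
have [B uB [Bx By]] := nf _ irr_rho tlam.
have [B' uB' [Bx' By']] := nf _ irr_sigma (etrans (esym tx) tlam).
rewrite -txy -ty in Bx' By'.
have uA : invmx B' *m B \in unitmx by rewrite unitmx_mul unitmx_inv uB' uB.
apply: (conjugate_repW uA).
  by exists (sqrtC (\det (invmx B' *m B))); rewrite sqrtCK.
have eqAB (S R N : 'M[C]_2) : B *m R = N *m B -> B' *m S = N *m B' ->
  S *m (invmx B' *m B) = invmx B' *m B *m R.
  move=> BR BS; apply: (can_inj (mulKmx uB')).
  by rewrite !mulmxA BS mulmxK // mulmxV // mul1mx BR.
apply: rep_conj_gen uA _; elim/ord2_ind; rewrite ?ord2_max.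
  exact: eqAB Bx Bx'.
exact: eqAB By By'.
Qed.

Section Torus.
Variables p q : nat.
Hypotheses (p_gt0 : (0 < p)%N) (q_gt0 : (0 < q)%N).
Implicit Type rho : SL2_rep C (torus_group p q).

Lemma irreducible_not_scalar rho a b : irreducible_rep rho ->
  rho (tx p q) = a%:M \/ rho (ty p q) = b%:M -> False.
Proof.
move=> irr [Xa|Yb].
  have [c /eigenvalueP[v vY v0]] := eigenvalue_closed (rho (ty p q)) (isT : 0 < 2)%N.
  apply: (irreducible_gen irr v0 _ vY (a := a)).
  by rewrite -[rho _]/(rho (tx p q)) Xa mul_mx_scalar.
have [c /eigenvalueP[v vX v0]] := eigenvalue_closed (rho (tx p q)) (isT : 0 < 2)%N.
apply: (irreducible_gen irr v0 vX _ (b := b)).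
by rewrite -[rho _]/(rho (ty p q)) Yb mul_mx_scalar.
Qed.

Lemma irreducible_torus_eigen rho : irreducible_rep rho -> acyclic_rep rho ->
  exists lam nu,
    [/\ lam ^+ p = -1, lam ^+ 2 != 1 & \tr (rho (tx p q)) = lam + lam^-1] /\
    [/\ nu ^+ q = -1, nu ^+ 2 != 1 & \tr (rho (ty p q)) = nu + nu^-1].
Proof.
move=> irr acyc.
set X := rho (tx p q); set Y := rho (ty p q).
have XY : X ^+ p = Y ^+ q := torus_relation rho.
have [z eigz] := eigenvalue_closed (X ^+ p) (isT : 0 < 2)%N.
have Xz : X ^+ p = z%:M.
  (* As a power of [X] and also of [Y], the matrix commutes with both generators. *)
  apply: schur irr eigz _; elim/ord2_ind; rewrite ?ord2_max.
    exact: (esym (commrX p (commr_refl X))).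
  by rewrite XY; exact: (esym (commrX q (commr_refl Y))).
(* An eigenvalue 1 or -1 together with a scalar [n]-th power would make [A] itself scalar, which
   irreducibility excludes for [X] and [Y]. *)
have eig (A : 'M[C]_2) n : (0 < n)%N -> \det A = 1 -> (forall a, A <> a%:M) ->
    A ^+ n = z%:M ->
  exists lam, [/\ lam ^+ n = z, lam ^+ 2 != 1, lam != 0 & \tr A = lam + lam^-1].
  move=> n0 dA nscal Az.
  have [lam eigl] := eigenvalue_closed A (isT : 0 < 2)%N.
  have [lam0 tA] := eigenvalue2 dA eigl.
  have /eigenvalueP[v vA v0] := eigl.
  exists lam; split=> //.
    have : (lam ^+ n - z) *: v == 0.
      by rewrite scalerBl -(row_mulX n vA) Az mul_mx_scalar subrr.
    by rewrite scaler_eq0 (negPf v0) orbF subr_eq0 => /eqP.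
  apply/eqP => lam2; apply: (nscal lam).
  by apply: (SL2_scalar_of_expr n0 _ dA tA lam0 lam2 Az); rewrite pnatr_eq0 -lt0n.
have nX a : X <> a%:M by move=> Xa; apply: (@irreducible_not_scalar rho a 0 irr); left.
have nY a : Y <> a%:M by move=> Ya; apply: (@irreducible_not_scalar rho 0 a irr); right.
have [lam [lamz lam2 lam0 tX]] := eig X p p_gt0 (rep_det _ _) nX Xz.
have [nu [nuz nu2 nu0 tY]] := eig Y q q_gt0 (rep_det _ _) nY (etrans (esym XY) Xz).
(* Taking determinants gives [z^2 = 1]; the value 1 contradicts acyclicity. *)
suff zN1 : z = -1 by exists lam, nu; rewrite -zN1.
have : z ^+ 2 = 1.
  have := congr1 determinant Xz; rewrite det_scalar => <-.
  by rewrite -(repX rho) rep_det.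
move/eqP; rewrite sqrf_eq1 => /orP[/eqP z1|/eqP //].
have tr_neq2 (a : C) : a != 0 -> a ^+ 2 != 1 -> a + a^-1 != 2.
  move=> a0; apply: contra => /eqP a2; suff: (a - 1) ^+ 2 == 0.
    by rewrite sqrf_eq0 subr_eq0 => /eqP ->; rewrite expr1n.
  have -> : (a - 1) ^+ 2 = a * (a + a^-1 - 2) by field.
  by rewrite a2 subrr mulr0.
case: (@torus_not_acyclic C p q rho) => //.
- by rewrite -/X Xz z1.
- by rewrite -/X tX tr_neq2.
- by rewrite -/Y tY tr_neq2.
Qed.

(** Both powers are expanded by [expz_SL2]. The result is affine in the trace of [X Y], based at the
    reducible value [lam nu + (lam nu)^-1], where the meridian has trace [L / M + M / L]. *)
Lemma trace_meridian rho (r s : int) (lam nu : C) :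
    let L := lam ^ r in let M := nu ^ s in
    lam != 0 -> nu != 0 ->
    \tr (rho (tx p q)) = lam + lam^-1 -> \tr (rho (ty p q)) = nu + nu^-1 ->
  (lam - lam^-1) * (nu - nu^-1) * \tr (rho (meridian p q r s)) =
    (lam - lam^-1) * (nu - nu^-1) * (L * M^-1 + L^-1 * M)
    - (L - L^-1) * (M - M^-1) *
       (\tr (rho (tx p q) *m rho (ty p q)) - (lam * nu + lam^-1 * nu^-1)).
Proof.
move=> L M lam0 nu0 tX tY; rewrite /meridian repM !rep_zexpg.
set X := rho (tx p q) in tX *; set Y := rho (ty p q) in tY *.
have L0 : L != 0 by rewrite expfz_neq0.
have M0 : M != 0 by rewrite expfz_neq0.
have EX := expz_SL2 (- r) (rep_det rho (tx p q)) lam0 tX.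
have EY := expz_SL2 s (rep_det rho (ty p q)) nu0 tY.
rewrite opprK -(invr_expz lam r) -/L -/X in EX.
rewrite -(invr_expz nu s) -/M -/Y in EY.
rewrite (_ : _ * \tr _ =
  \tr (((lam - lam^-1) *: X ^ (- r)) *m ((nu - nu^-1) *: Y ^ s))); last first.
  by rewrite -scalemxAl -scalemxAr !mxtraceZ mulrA.
rewrite EX EY; move: tX tY; rewrite !(mx2E, mxE) /=.
(* Eliminating one diagonal entry of each matrix leaves an identity of rational functions. *)
move=> tX tY; have X11 : X 1 1 = lam + lam^-1 - X 0 0 by rewrite -tX addrC addKr.
have -> : Y 1 1 = nu + nu^-1 - Y 0 0 by rewrite -tY addrC addKr.
by rewrite X11; field; rewrite lam0 nu0 L0 M0.
Qed.

(** * Existence and uniqueness for given eigenvalues and meridian trace *)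

Section FixedEigenvalues.
Variables (r s : int) (lam nu : C).
Hypotheses (rs : p%:Z * s - q%:Z * r = 1).
Hypotheses (lamp : lam ^+ p = -1) (lam2 : lam ^+ 2 != 1).
Hypotheses (nuq : nu ^+ q = -1) (nu2 : nu ^+ 2 != 1).

Let root_neq0 (a : C) n : (0 < n)%N -> a ^+ n = -1 -> a != 0.
Proof.
move=> n0 an; apply: contra_eq_neq an => ->.
by rewrite expr0n eqn0Ngt n0 eq_sym oppr_eq0 oner_eq0.
Qed.

Let lam0 : lam != 0 := root_neq0 p_gt0 lamp.
Let nu0 : nu != 0 := root_neq0 q_gt0 nuq.

(* Bezout: a power k coprime to n cannot trivialise a^2 when a^n = -1 *)
Let expz_neq1 (a : C) n (k u v : int) : a != 0 -> a ^+ n = -1 -> a ^+ 2 != 1 ->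
  k * u + n%:Z * v = 1 -> (a ^ k) ^+ 2 != 1.
Proof.
move=> a0 an a2 bez; apply: contra a2 => /eqP ak; apply/eqP.
have -> : a ^+ 2 = (a ^+ 2) ^ (k * u + n%:Z * v) by rewrite bez expr1z.
rewrite expfzDr ?expf_neq0 // -!exprz_exp.
rewrite (_ : (a ^+ 2) ^ k = 1); last by rewrite -ak !exprnP !exprz_exp mulrC.
rewrite (_ : (a ^+ 2) ^ n = 1) ?exp1rz ?mulr1 //.
by rewrite -exprnP -exprM mulnC exprM an sqrrN expr1n.
Qed.

Let lamr2 : (lam ^ r) ^+ 2 != 1.
Proof.
by apply: (expz_neq1 (u := - q%:Z) (v := s)) lamp lam2 _ => //; rewrite -rs; ring.
Qed.

Let nus2 : (nu ^ s) ^+ 2 != 1.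
Proof.
by apply: (expz_neq1 (u := p%:Z) (v := - r)) nuq nu2 _ => //; rewrite -rs; ring.
Qed.

(** The slope in [trace_meridian] is nonzero because [p s - q r = 1] makes [r] prime to [p] and [s]
    prime to [q]. *)
Lemma eq_trace_meridian rho (sigma : SL2_rep C (torus_group p q)) :
    \tr (rho (tx p q)) = lam + lam^-1 -> \tr (rho (ty p q)) = nu + nu^-1 ->
    \tr (sigma (tx p q)) = lam + lam^-1 -> \tr (sigma (ty p q)) = nu + nu^-1 ->
    \tr (rho (meridian p q r s)) = \tr (sigma (meridian p q r s)) ->
  \tr (rho (tx p q) *m rho (ty p q)) = \tr (sigma (tx p q) *m sigma (ty p q)).
Proof.
move=> rx ry sx sy mu.
have := trace_meridian r s lam0 nu0 rx ry; rewrite mu.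
rewrite (trace_meridian r s lam0 nu0 sx sy).
move/addrI/oppr_inj/mulfI => /(_ _)/addIr -> //.
by rewrite mulf_neq0 // sub_inv_neq0 // expfz_neq0.
Qed.

Lemma exists_torus_rep (c : C) :
    c != lam ^ r * nu ^ s + (lam ^ r * nu ^ s)^-1 ->
    c != lam ^ r / nu ^ s + (lam ^ r / nu ^ s)^-1 ->
  exists rho, [/\ irreducible_rep rho, \tr (rho (tx p q)) = lam + lam^-1,
    \tr (rho (ty p q)) = nu + nu^-1 & \tr (rho (meridian p q r s)) = c].
Proof.
set L := lam ^ r; set M := nu ^ s => c1 c2.
have L0 : L != 0 by rewrite expfz_neq0.
have M0 : M != 0 by rewrite expfz_neq0.
have LV0 : L - L^-1 != 0 by apply: sub_inv_neq0.
have MV0 : M - M^-1 != 0 by apply: sub_inv_neq0.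
have lV0 : lam - lam^-1 != 0 by apply: sub_inv_neq0.
have nV0 : nu - nu^-1 != 0 by apply: sub_inv_neq0.
(* Solving [trace_meridian] for the trace of [X Y] gives [tau]; [d] is minus the reciprocal of the
   slope. [X] and [Y] are then the normal form with these traces. *)
pose d := (lam - lam^-1) * (nu - nu^-1) / ((L - L^-1) * (M - M^-1)).
have d0 : d != 0 by rewrite !mulf_neq0 ?invr_eq0 ?mulf_neq0.
pose tau := lam * nu + lam^-1 * nu^-1 - d * (c - (L * M^-1 + L^-1 * M)).
pose X := mx2 lam 0 (tau - lam^-1 * (nu + nu^-1)) lam^-1.
pose Y := mx2 0 1 (-1) (nu + nu^-1).
have dX : \det X = 1 by rewrite det2E !mxE /= mul0r subr0 mulfV.
have dY : \det Y = 1 by rewrite det2E !mxE /=; ring.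
have tX : \tr X = lam + lam^-1 by rewrite tr2E !mxE.
have tY : \tr Y = nu + nu^-1 by rewrite tr2E !mxE /= add0r.
have tXY : \tr (X *m Y) = tau by rewrite !(mx2E, mxE) /=; ring.
pose Mgen (k : 'I_2) := if k == 0 then X else Y.
have dM k : \det (Mgen k) = 1 by rewrite /Mgen; case: ifP.
have rel : word_mx Mgen (torus_relator p q) = 1.
  rewrite /word_mx /torus_relator big_cat !big_nseq -!Monoid.iteropE /letter_mx /=.
  rewrite -![iterop _ _ _ _]/(_ ^+ _) exprVn.
  by rewrite (SL2_expN1 dX tX) // (SL2_expN1 dY tY) // invrN1 mulrNN mulr1.
pose rho : SL2_rep C (torus_group p q) := word_rep dM rel.
have rx : rho (tx p q) = X := word_rep_gen dM rel ord0.
have ry : rho (ty p q) = Y := word_rep_gen dM rel ord_max.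
have irr : irreducible_rep rho.
  move=> U stabU; apply: (@irreducible_commutator _ X Y).
  (* The commutator is singular exactly at the two reducible values of [tau], and these correspond
     to the two excluded values of [c]. *)
  - have -> : \det (X *m Y - Y *m X) =
        - ((tau - (lam * nu + lam^-1 * nu^-1)) * (tau - (lam * nu^-1 + lam^-1 * nu))).
      by rewrite !(mx2E, mxE) /=; field; rewrite lam0 nu0.
    have -> : tau - (lam * nu + lam^-1 * nu^-1) = - d * (c - (L / M + (L / M)^-1)).
      by rewrite /tau; field; rewrite lam0 nu0 L0 M0.
    have -> : tau - (lam * nu^-1 + lam^-1 * nu) = - d * (c - (L * M + (L * M)^-1)).
      by rewrite /tau /d; field; rewrite -!expr2 !subr_eq0 lam0 nu0 L0 M0 lamr2 nus2.
    rewrite oppr_eq0; apply: mulf_neq0; apply: mulf_neq0; rewrite ?oppr_eq0 //.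
      by rewrite subr_eq0.
    by rewrite subr_eq0.
  - by rewrite -rx.
  - by rewrite -ry.
exists rho; split; rewrite ?rx ?ry //.
have e := trace_meridian (rho := rho) r s lam0 nu0.
rewrite rx ry in e; have {e} := e tX tY.
rewrite tXY -/L -/M /tau => e.
have l2 : (lam - lam^-1) * (nu - nu^-1) != 0 by rewrite mulf_neq0.
apply: (mulfI l2); rewrite e /d; field.
by rewrite -!expr2 !subr_eq0 lam0 nu0 L0 M0 lamr2 nus2.
Qed.
End FixedEigenvalues.
End Torus.
End Classification.

(** * Power sums over odd multiples of pi / n *)

Section SineSums.

(** Induction strips both end terms. This folds the sum over odd exponents under [a -> 2n - a] and
    the binomial sum under [l -> -l]. *)
Lemma symmetric_sum (V : nmodType) h (g : nat -> V) :
    (forall i, (i <= h.*2)%N -> g (h.*2 - i)%N = g i) ->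
  \sum_(i < h.*2.+1) g i = g h + (\sum_(i < h) g i) *+ 2.
Proof.
elim: h g => [|h IHh] g sym; first by rewrite big_ord1 big_ord0 mul0rn addr0.
rewrite doubleS big_ord_recl big_ord_recr /=.
under eq_bigr do rewrite /bump /= add1n.
rewrite (IHh (g \o succn)) /=; last first.
  move=> i ih; rewrite -[RHS]sym ?doubleS /bump ?add1n; last lia.
  by congr g; lia.
rewrite big_ord_recl mulrnDl /=.
under [in RHS]eq_bigr do rewrite /bump /= add1n.
have -> : g h.*2.+2 = g 0 by rewrite -[RHS]sym // subn0 doubleS.
by rewrite !mulr2n -!addrA addrCA; congr (_ + (_ + _)); rewrite addrA addrC.
Qed.

Variables (F : numFieldType) (n : nat) (z : F).
Hypotheses (n_gt0 : (0 < n)%N) (prim_z : n.*2.-primitive_root z) (zn : z ^+ n = -1).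

Let z0 : z != 0.
Proof.
apply: contra_eq_neq zn => ->.
by rewrite expr0n eqn0Ngt n_gt0 eq_sym oppr_eq0 oner_eq0.
Qed.

Let z2n : z ^+ n.*2 = 1.
Proof. exact: prim_expr_order prim_z. Qed.

(* For z = exp(i pi / n) this is |1 - z^a|^2 = 4 sin^2(a pi / 2n). *)
Definition chord a := 2 - (z ^+ a + (z ^+ a)^-1).

Lemma chord_sym a : (a <= n.*2)%N -> chord (n.*2 - a) = chord a.
Proof.
move=> an; rewrite /chord expfB_cond ?(negPf z0) // z2n div1r invrK.
by rewrite [_^-1 + _]addrC.
Qed.

(** Here [lam = z^i] with [i] odd and below [2n]. The case [i = n] means [lam = -1], which is
    excluded; for [i > n], passing to [2n - i] inverts the root and keeps the trace. *)
Lemma trace_odd_root lam : lam ^+ n = -1 -> lam ^+ 2 != 1 ->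
  exists2 a : 'I_n, odd a & lam + lam^-1 = z ^+ a + (z ^+ a)^-1.
Proof.
move=> lamn lam2.
have /(prim_rootP prim_z)[i lami] : lam ^+ n.*2 = 1.
  by rewrite -muln2 exprM lamn sqrrN expr1n.
have odd_i : odd i.
  move: lamn; rewrite lami -exprM mulnC exprM zn -signr_odd.
  by case: (odd i) => // /eqP; rewrite expr0 -addr_eq0 -mulr2n pnatr_eq0.
have [ltin|lein] := ltnP i n.
  by exists (Ordinal ltin) => //=; rewrite lami.
have neq_in : n != i.
  apply: contra lam2 => /eqP in_; rewrite lami -in_ zn sqrrN expr1n //.
have lt2in : (n.*2 - i < n)%N by have := ltn_ord i; lia.
exists (Ordinal lt2in) => /=; first by rewrite oddB ?odd_double ?(ltnW (ltn_ord i)).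
rewrite expfB_cond ?(negPf z0) ?(ltnW (ltn_ord i)) // z2n div1r invrK lami.
by rewrite addrC.
Qed.

(** Equal traces mean [(z^a - z^b) (z^(a + b) - 1) = 0]. As [a + b < 2n], the second factor vanishes
    only for [a = b = 0]. *)
Lemma trace_inj (a b : 'I_n) :
  z ^+ a + (z ^+ a)^-1 = z ^+ b + (z ^+ b)^-1 -> a = b.
Proof.
move=> eqab; have : (z ^+ a - z ^+ b) * (z ^+ (a + b) - 1) == 0.
  rewrite exprD (_ : _ * _ = z ^+ a * z ^+ b *
    ((z ^+ a + (z ^+ a)^-1) - (z ^+ b + (z ^+ b)^-1))).
    by rewrite eqab subrr mulr0.
  by field; rewrite !expf_neq0.
have [lta ltb] := (ltn_ord a, ltn_ord b).
rewrite mulf_eq0 !subr_eq0 (eq_prim_root_expr prim_z) -(prim_order_dvd prim_z).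
case/orP => [|/dvdnP[k abk]].
  by rewrite !modn_small; [move/eqP/val_inj| lia..].
case: k abk => [|k]; last by nia.
by move=> ab0; apply: val_inj => /=; lia.
Qed.

Definition odd_chord_sum m := \sum_(a < n | odd a) chord a ^+ m.

(** The involution [a -> 2n - a] pairs the odd exponents below [2n]. Its fixed point [n] counts only
    for odd [n], with [chord n = 4]. *)
Lemma sum_odd_chord m :
  \sum_(k < n) chord k.*2.+1 ^+ m = odd_chord_sum m *+ 2 + 4 ^+ m * (n %% 2)%:R.
Proof.
(* Zeros at even indices make the range from 0 to [2n] symmetric. *)
pose g a := if odd a then chord a ^+ m else 0.
have -> : \sum_(k < n) chord k.*2.+1 ^+ m = \sum_(a < n.*2.+1) g a.
  elim: (n) => [|h IHh]; first by rewrite big_ord0 big_ord1.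
  rewrite doubleS [RHS]big_ord_recr /= [X in X + _]big_ord_recr /= -IHh.
  rewrite [LHS]big_ord_recr /g /= odd_double /=.
  by rewrite addr0.
rewrite symmetric_sum => [|i i2n]; last by rewrite /g chord_sym // oddB // odd_double.
rewrite addrC /odd_chord_sum [in RHS]big_mkcond /=; congr (_ + _).
rewrite /g modn2; case: (odd n); last by rewrite mulr0.
by rewrite mulr1 /chord zn invrN1; congr (_ ^+ _); ring.
Qed.

(** A geometric series of ratio [z^(2K)], which is 1 exactly when [n] divides [K]; otherwise the [n]
    terms run through full periods and cancel. *)
Lemma sum_odd_root K :
  \sum_(k < n) z ^+ (k.*2.+1 * K) = if (n %| K)%N then n%:R * (-1) ^+ (K %/ n) else 0.
Proof.
case: ifP => [/dvdnP[t ->]|nK].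
  rewrite mulnK // mulr_natl -[n in RHS]card_ord -sumr_const; apply: eq_bigr => k _.
  by rewrite mulnA mulnC exprM zn exprM -(signr_odd _ k.*2.+1) /= odd_double.
have -> : \sum_(k < n) z ^+ (k.*2.+1 * K) = z ^+ K * \sum_(k < n) (z ^+ K.*2) ^+ k.
  by rewrite big_distrr /=; apply: eq_bigr => k _; rewrite -exprM -exprD;
    congr (_ ^+ _); lia.
have z1 : z ^+ K.*2 - 1 != 0.
  by rewrite subr_eq0 -(prim_order_dvd prim_z) -!muln2 dvdn_pmul2r // nK.
apply: (mulfI z1); rewrite mulr0 mulrCA -subrX1 -exprM.
by rewrite -doubleMl mulnC doubleMl exprM z2n expr1n subrr mulr0.
Qed.

(* Since z^(2n) = 1, the exponent (2n - 1) m stands for - m. *)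
Lemma chord_expansion a m : chord a ^+ m =
  \sum_(k < m.*2.+1)
    (-1) ^+ (m + k) * ('C(m.*2, k))%:R * z ^+ (a * (k + n.*2.-1 * m)).
Proof.
set w := z ^+ a; have w0 : w != 0 by rewrite expf_neq0.
have wV : w^-1 = w ^+ n.*2.-1.
  apply: (mulfI w0); rewrite mulfV // -exprS prednK ?double_gt0 //.
  by rewrite -exprM mulnC exprM z2n expr1n.
have -> : chord a = - w^-1 * (1 - w) ^+ 2 by rewrite /chord -/w; field.
rewrite exprMn -exprM mul2n exprDn big_distrr /=; apply: eq_bigr => k _.
have -> : z ^+ (a * (k + n.*2.-1 * m)) = w ^+ k * w^-1 ^+ m.
  by rewrite exprM -/w exprD exprM -wV.
rewrite expr1n mul1r (exprNn w) (exprNn w^-1) [(-1) ^+ (m + k)]exprD -mulr_natr.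
by ring.
Qed.

(** After expanding and exchanging the sums, [sum_odd_root] keeps only the [k] congruent to [m]
    modulo [n], that is [k = m + n l]. *)
Lemma odd_chord_binomial m :
  odd_chord_sum m *+ 2 + 4 ^+ m * (n %% 2)%:R = n%:R * binomial_sum F n m.
Proof.
rewrite -sum_odd_chord; under eq_bigr do rewrite chord_expansion.
rewrite exchange_big /=.
under eq_bigr => k _ do rewrite -big_distrr /= sum_odd_root.
have dvdK k : (n %| k + n.*2.-1 * m)%N = (k == m %[mod n]).
  rewrite -(eqn_modDr (n.*2.-1 * m)) -mulSn prednK ?double_gt0 //.
  by rewrite -muln2 -mulnA modnMr.
rewrite (bigID (fun k : 'I__ => n %| k + n.*2.-1 * m)%N) /= [X in _ + X]big1 ?addr0;
  last first.
  by move=> k /negPf ->; rewrite mulr0.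
have small (i : 'I_(m %/ n).*2.+1) : (m %% n + n * i < m.*2.+1)%N.
  by have := ltn_ord i; have := divn_eq m n; have := ltn_pmod m n_gt0; nia.
(* The smallest admissible [k] is [m mod n], so [i] stands for [l = i - floor(m / n)]. *)
pose h i : 'I_m.*2.+1 := Ordinal (small i).
rewrite (reindex_onto h (fun k => inord (k %/ n))) /=; last first.
  move=> k; rewrite dvdK => /eqP km; apply: val_inj => /=; rewrite inordK.
    by rewrite -km [RHS](divn_eq k n) addnC mulnC.
  have := divn_eq k n; have := divn_eq m n; have := ltn_pmod m n_gt0.
  have := ltn_ord k; rewrite km; set u := (k %/ n)%N; set t := (m %/ n)%N => *.
  rewrite ltnS leqNgt; apply/negP => ut.
  (* If [u > 2t], then [k = n u + (m mod n)] is at least [2nt + n + (m mod n)], which exceeds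
     [2m]. *)
  have : (n * t.*2.+1 <= n * u)%N by rewrite leq_mul2l ut orbT.
  by rewrite mulnS -doubleMr; nia.
rewrite /binomial_sum big_distrr /=; apply: eq_big => [i|i _].
  rewrite dvdK /= addnC mulnC modnMDl modn_mod eqxx /=; apply/eqP/val_inj => /=.
  by rewrite divnMDl // [(m %% n %/ n)%N]divn_small ?ltn_pmod // addn0 inordK.
set t := (m %/ n)%N; set k := (m %% n + n * i)%N.
have mE : m = (t * n + m %% n)%N := divn_eq m n.
have -> : m%:Z + n%:Z * (i%:Z - t%:Z) = k%:Z.
  by rewrite {1}mE /k !PoszD !PoszM; ring.
have tm : (t <= m)%N by rewrite leq_div.
have even1 j : (-1) ^+ j.*2 = 1 :> F by rewrite -mul2n exprM sqrrN !expr1n.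
have -> : (k + n.*2.-1 * m = (i + m.*2 - t) * n)%N.
  have e1 : (n.*2.-1 * m + m = n * m.*2)%N.
    by rewrite -mulSnr prednK ?double_gt0 // -doubleMl doubleMr.
  have e2 : ((i + m.*2 - t) * n + t * n = i * n + m.*2 * n)%N.
    by rewrite -!mulnDl subnK //; lia.
  by move: e1 e2; rewrite /k; nia.
rewrite dvdn_mull // mulnK // absz_nat.
(* With [l = i - t], the binomial sign has the parity of [k - m = n l] and the root of unity
   contributes [(-1)^l], together [(-1)^((n + 1) l)]. *)
have -> : (-1) ^ (n.+1%:Z * (i%:Z - t%:Z)) =
    (-1) ^+ (m + k) * (-1) ^+ (i + m.*2 - t) :> F.
  rewrite -exprD (_ : m + k + (i + m.*2 - t) =
    n.+1 * (i + t) + (m %% n + m - t).*2)%N; last first.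
    by rewrite {1}mE /k; nia.
  rewrite (_ : _ * (_ - _) = (n.+1 * (i + t))%N%:Z - (n.+1 * t).*2%:Z).
    by rewrite expfzDr ?oppr_eq0 ?oner_eq0 // -invr_expz -!exprnP exprD !even1 invr1.
  by rewrite -(muln2 (n.+1 * t)) !PoszM !PoszD; ring.
by ring.
Qed.

Lemma torus_factorE m : torus_factor F n m = odd_chord_sum m / 2 ^+ m.
Proof.
have two0 : 2 != 0 :> F by rewrite pnatr_eq0.
rewrite /torus_factor expfzDr // exprN1 -exprnP.
have := odd_chord_binomial m; rewrite (_ : 4 = 2 * 2 :> F); last by ring.
rewrite exprMn mulr2n => e.
by rewrite mulrAC -e exprS; field; rewrite expf_neq0.
Qed.

(** The terms for [l] and [-l] agree by the symmetry of the binomial coefficients; [l = 0] gives the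
    central one. *)
Lemma binomial_sum_int m : exists b : int,
  binomial_sum F n m = ('C(m.*2, m))%:R + b%:~R *+ 2.
Proof.
set t := (m %/ n)%N.
pose g (i : nat) : int := let l : int := i%:Z - t%:Z in
     (-1) ^ (n.+1%:Z * l) * ('C(m.*2, absz (m%:Z + n%:Z * l)))%:R.
have -> : binomial_sum F n m = (\sum_(i < t.*2.+1) g i)%:~R.
  rewrite rmorph_sum; apply: eq_bigr => i _ /=.
  by rewrite /g rmorphM rmorphXz ?unitrN1 // rmorphN1 rmorph_nat.
exists (\sum_(i < t) g i); rewrite symmetric_sum.
  rewrite rmorphD /= rmorphMn /= /g subrr !mulr0 addr0 expr0z mul1r absz_nat.
  by rewrite rmorph_nat.
move=> i i2t; rewrite /g.
have -> : (t.*2 - i)%N%:Z - t%:Z = - (i%:Z - t%:Z) by lia.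
rewrite !mulrN -exprz_inv invrN1; congr (_ * _%:R).
have tm : (n * t <= m)%N by rewrite mulnC leq_divM.
set y := n%:Z * _; have yE : y = n%:Z * i%:Z - n%:Z * t%:Z by rewrite /y mulrBr.
have [y1 y2] : y <= m%:Z /\ - m%:Z <= y.
  have i2tn : (n * i <= n * t.*2)%N by rewrite leq_mul2l i2t orbT.
  by split; rewrite yE; lia.
rewrite -bin_sub; last lia.
by congr 'C(_, _); lia.
Qed.

(** By [odd_chord_binomial] twice the sum is an integer, and it must be shown even. For [m > 0] both
    [C(2m, m)] and [4^m] are even; for [m = 0] the parities of [n] and [n mod 2] agree. *)
Lemma odd_chord_sum_int m : exists k : int, odd_chord_sum m = k%:~R.
Proof.
have [b bE] := binomial_sum_int m.
have [e eE] : exists e : int,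
    (n * 'C(m.*2, m))%N%:Z = e *+ 2 + (4 ^ m * (n %% 2))%N%:Z.
  case: m {b bE} => [|m].
    by exists (n %/ 2)%N%:Z; rewrite bin0 muln1 expn0 mul1n {1}(divn_eq n 2); lia.
  exists ((n * 'C(m.*2.+1, m))%N%:Z - (2 * 4 ^ m * (n %% 2))%N%:Z).
  rewrite doubleS binS expnS.
  have -> : 'C(m.*2.+1, m.+1) = 'C(m.*2.+1, m).
    by rewrite -bin_sub; last lia; congr 'C(_, _); lia.
  by nia.
exists (e + n%:Z * b); apply/eqP; rewrite -[_ == _]/((2 == 0)%N || _) -eqrMn2r;
  apply/eqP.
apply: (addIr (4 ^+ m * (n %% 2)%:R)); rewrite odd_chord_binomial bE.
have eE' : n%:R * ('C(m.*2, m))%:R = e%:~R *+ 2 + 4 ^+ m * (n %% 2)%:R :> F.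
  rewrite -natrX -!natrM (pmulrn 1 (n * _)) eE intrD -pmulrn; congr (_ + _).
  by rewrite mulr2n intrD mulr2n.
rewrite mulrDr eE' intrD intrM; ring.
Qed.
End SineSums.

(** * The root of unity exp(i pi / n) *)

Section UnitCircle.
Variable R : realType.
Implicit Types x y : R.

Definition expi x : R[i] := cos x +i* sin x.

Lemma expi0 : expi 0 = 1.
Proof. by rewrite /expi cos0 sin0. Qed.

Lemma expiD x y : expi (x + y) = expi x * expi y.
Proof. by rewrite /expi cosD sinD; simpc; congr (_ +i* _); rewrite addrC. Qed.

Lemma expiN x : expi (- x) = (expi x)^-1.
Proof.
have e : expi x * expi (- x) = 1 by rewrite -expiD subrr expi0.
exact/esym/(GRing.mulr1_eq e).
Qed.

Lemma expi_neq0 x : expi x != 0.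
Proof.
have e : expi x * expi (- x) = 1 by rewrite -expiD subrr expi0.
by apply: contra_eq_neq e => ->; rewrite mul0r eq_sym oner_eq0.
Qed.

Lemma expiMn x n : expi (x *+ n) = expi x ^+ n.
Proof. by elim: n => [|n IHn]; rewrite ?mulr0n ?expi0 // mulrS expiD IHn exprS. Qed.

Lemma expiMz x (k : int) : expi (x *~ k) = expi x ^ k.
Proof. by case: k => n; rewrite ?NegzE ?mulrNz ?expiN -?pmulrn expiMn -?invr_expz. Qed.

Lemma expi_add_inv x : expi x + (expi x)^-1 = (2 * cos x)%:C.
Proof.
apply/eqP; rewrite -expiN eq_complex /= cosN sinN subrr eqxx andbT.
by rewrite mulr_natl mulr2n.
Qed.

Definition zeta n := expi (pi / n%:R).

Lemma zetaX n a : zeta n ^+ a = expi (pi * (a%:R / n%:R)).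
Proof. by rewrite -expiMn -mulr_natr; congr expi; ring. Qed.

Lemma zeta_exp n : (0 < n)%N -> zeta n ^+ n = -1.
Proof.
move=> n0; rewrite zetaX mulfV ?pnatr_eq0 -?lt0n // mulr1.
by rewrite /expi cospi sinpi; apply/eqP; rewrite eq_complex /= oppr0 !eqxx.
Qed.

(** The order [m] divides [2n]; if proper, it is at most [n]. But [m = n] contradicts [zeta^n = -1],
    and for [m < n] the imaginary part [sin(pi m / n)] is positive. *)
Lemma zeta_prim n : (0 < n)%N -> n.*2.-primitive_root (zeta n).
Proof.
move=> n0; have zn := zeta_exp n0.
have z2n : zeta n ^+ n.*2 = 1 by rewrite -muln2 exprM zn sqrrN expr1n.
have [m prim_m m_dvd] := prim_order_exists (etrans (double_gt0 n) n0) z2n.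
suff -> : n.*2 = m by [].
have m_gt0 := prim_order_gt0 prim_m; have zm := prim_expr_order prim_m.
have [k nk] := dvdnP m_dvd; case: k nk => [|[|k]] nk; [lia | lia | exfalso].
have [mn|nm|mn] := ltngtP m n; last 2 first.
- by move: nm; nia.
- by move/eqP: zm; rewrite mn zn -subr_eq0 -opprD oppr_eq0 -mulr2n pnatr_eq0.
have mn0 : 0 < m%:R / n%:R :> R by rewrite divr_gt0 ?ltr0n.
have mn1 : m%:R / n%:R < 1 :> R by rewrite ltr_pdivrMr ?ltr0n // mul1r ltr_nat.
have pos : 0 < sin (pi * (m%:R / n%:R) : R).
  by apply: sin_gt0_pi; rewrite mulr_gt0 ?pi_gt0 //= gtr_pMr ?pi_gt0.
by move/eqP: zm; rewrite zetaX eq_complex /= (gt_eqF pos) andbF.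
Qed.
End UnitCircle.

(** * Acyclic classes with prescribed meridian trace *)

Section Main.
Variables (R : realType) (p q : nat) (r s : int) (c : R[i]).
Hypotheses (p_gt0 : (0 < p)%N) (q_gt0 : (0 < q)%N) (rs : p%:Z * s - q%:Z * r = 1).

Let zp : R[i] := zeta R p.
Let zq : R[i] := zeta R q.
Let zpP := zeta_exp R p_gt0.
Let zqP := zeta_exp R q_gt0.
Let zp_prim := zeta_prim R p_gt0.
Let zq_prim := zeta_prim R q_gt0.

(* The part of the component X*_{2,(a,b)} of the paper on which tr rho(mu) = c. *)
Definition torus_component (ab : 'I_p * 'I_q) : set (SL2_rep R[i] (torus_group p q)) :=
  [set rho | [/\ irreducible_rep rho, \tr (rho (meridian p q r s)) = c,
     \tr (rho (tx p q)) = zp ^+ ab.1 + (zp ^+ ab.1)^-1 &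
     \tr (rho (ty p q)) = zq ^+ ab.2 + (zq ^+ ab.2)^-1]].

Definition odd_pairs : set ('I_p * 'I_q) :=
  [set ab : 'I_p * 'I_q | odd ab.1 && odd ab.2].

Let zp0 a : zp ^+ a != 0. Proof. by rewrite expf_neq0 ?expi_neq0. Qed.

Let odd_root (z : R[i]) n a : z ^+ n = -1 -> odd a -> (z ^+ a) ^+ n = -1.
Proof. by move=> zn oa; rewrite -exprM mulnC exprM zn -signr_odd oa. Qed.

Let odd_root2 (z : R[i]) n (a : 'I_n) : n.*2.-primitive_root z -> odd a ->
  (z ^+ a) ^+ 2 != 1.
Proof.
move=> prim oa; rewrite -exprM -(prim_order_dvd prim) muln2 -!muln2.
rewrite dvdn_pmul2r //; apply/negP => /dvdn_leq; have := ltn_ord a.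
by case: (val a) oa => // k _ lt /(_ isT); lia.
Qed.

Lemma torus_component_rep ab rho : odd_pairs ab -> torus_component ab rho ->
  [/\ irreducible_rep rho, acyclic_rep rho, \tr (rho (meridian p q r s)) = c &
   torsion rho = 4 / (chord zp ab.1 * chord zq ab.2)].
Proof.
case: ab => a b /andP[/= oa ob] [/= irr mu tx_ ty_].
have Xp := SL2_expN1 (rep_det rho (tx p q)) tx_ (zp0 a)
  (odd_root2 zp_prim oa) (odd_root zpP oa).
have two0 : 2 != 0 :> R[i] by rewrite pnatr_eq0.
have [ac tor] := torus_acyclic_torsion two0 Xp.
by split=> //; rewrite tor tx_ ty_.
Qed.

(** So a nonempty component is a single conjugacy class: the meridian trace determines the trace of
    [X Y], and the three traces determine the class. *)
Lemma torus_component_conj ab rho sigma : odd_pairs ab -> torus_component ab rho ->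
  (conjugate_rep rho sigma <-> torus_component ab sigma).
Proof.
case: ab => a b /andP[/= oa ob] [/= irr mu tx_ ty_]; split.
  move=> conj; have trE g : \tr (sigma g) = \tr (rho g).
    case: conj => A dA ->; rewrite mxtrace_mulC mulmxA mulVmx ?mul1mx //.
    by rewrite unitmxE dA unitr1.
  by split; rewrite ?trE //; exact: irreducible_conj conj irr.
move=> [/= irr' mu' tx' ty'].
apply: irreducible_conjugate; rewrite ?[LHS]tx_ ?[LHS]ty_ //.
apply: (eq_trace_meridian p_gt0 q_gt0 rs _ _ _ _ tx_ ty_ tx' ty').
5: by rewrite mu mu'.
- exact: odd_root zpP oa.
- exact: odd_root2 zp_prim oa.
- exact: odd_root zqP ob.
- exact: odd_root2 zq_prim ob.
Qed.

Hypothesis hc : forall a b : nat,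
      (0 < a < p)%N -> (0 < b < q)%N -> a = b %[mod 2] ->
      c <> (2 * cos (pi * (r%:~R * a%:R / p%:R + s%:~R * b%:R / q%:R)))%:C /\
      c <> (2 * cos (pi * (r%:~R * a%:R / p%:R - s%:~R * b%:R / q%:R)))%:C.

Lemma torus_component_nonempty ab : odd_pairs ab -> exists rho, torus_component ab rho.
Proof.
case: ab => a b /andP[/= oa ob].
have pos n (i : 'I_n) : odd i -> (0 < i < n)%N by rewrite ltn_ord andbT; case: (val i).
have [] := hc (pos _ _ oa) (pos _ _ ob); first by rewrite !modn2 oa ob.
have zz n (i : 'I_n) (k : int) :
    (zeta R n ^+ i) ^ k = expi (pi * (k%:~R * i%:R / n%:R)).
  by rewrite zetaX -expiMz -mulrzr; congr expi; ring.
(* Writing [2 cos t] as [exp(i t) + exp(-i t)] turns the excluded cosines into the excluded values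
   of [exists_torus_rep]. *)
rewrite -!expi_add_inv mulrDr mulrBr !expiD expiN -!zz => /eqP c1 /eqP c2.
have [rho [irr tx_ ty_ mu]] := exists_torus_rep p_gt0 q_gt0 rs (odd_root zpP oa)
  (odd_root2 zp_prim oa) (odd_root zqP ob) (odd_root2 zq_prim ob) c1 c2.
by exists rho.
Qed.

Lemma acyclic_classesE : acyclic_classes p q r s c = torus_component @` odd_pairs.
Proof.
apply/seteqP; split=> [_ [rho [irr ac mu] <-]|_ [ab oab <-]].
  have [lam [nu [[lamp lam2 tx_] [nuq nu2 ty_]]]] :=
    irreducible_torus_eigen p_gt0 q_gt0 irr ac.
  have [a oa lama] := trace_odd_root p_gt0 zp_prim zpP lamp lam2.
  have [b ob nub] := trace_odd_root q_gt0 zq_prim zqP nuq nu2.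
  have oab : odd_pairs (a, b) by apply/andP.
  have rho_ab : torus_component (a, b) rho by split; rewrite /= -?lama -?nub.
  exists (a, b) => //; apply/seteqP; split=> sigma;
    by move/(torus_component_conj sigma oab rho_ab).
have [rho rho_ab] := torus_component_nonempty oab.
have [irr ac mu _] := torus_component_rep oab rho_ab.
exists rho => //; apply/seteqP; split=> sigma;
  by move/(torus_component_conj sigma oab rho_ab).
Qed.

Lemma torus_component_inj : set_inj odd_pairs torus_component.
Proof.
move=> ab ab' /set_mem oab /set_mem oab' eqc.
have [rho rho_ab] := torus_component_nonempty oab.
have : torus_component ab' rho by rewrite -eqc.
case: rho_ab => _ _ tx_ ty_ [_ _]; rewrite tx_ ty_.
case: ab ab' {oab oab' eqc tx_ ty_} => a b [a' b'] /=.
move=> /(trace_inj p_gt0 zp_prim zpP) -> /(trace_inj q_gt0 zq_prim zqP) ->.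
by [].
Qed.

Lemma class_torsion_component ab : odd_pairs ab ->
  class_torsion (torus_component ab) = 4 / (chord zp ab.1 * chord zq ab.2).
Proof.
move=> oab; have [rho rho_ab] := torus_component_nonempty oab.
(* Whatever representation [xget] selects, its torsion is the stated value; nonemptiness rules out
   the default 0. *)
rewrite /class_torsion; case: xgetP => [t _ [sigma sab ->]|/(_ (torsion rho)) []].
  by have [] := torus_component_rep oab sab.
by exists rho.
Qed.

Lemma sum_class_torsion m :
  \sum_(X \in acyclic_classes p q r s c) (class_torsion X ^+ m)^-1 =
    odd_chord_sum p zp m * odd_chord_sum q zq m / 4 ^+ m.
Proof.
rewrite acyclic_classesE fsbig_image; last exact: torus_component_inj.
rewrite (eq_fsbigr (fun ab : 'I_p * 'I_q =>
  chord zp ab.1 ^+ m * chord zq ab.2 ^+ m / 4 ^+ m)); last first.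
  move=> ab /set_mem oab; rewrite class_torsion_component //.
  by rewrite !exprMn exprVn invfM invrK exprMn mulrC.
rewrite /odd_chord_sum big_distrlr /= pair_big /= big_distrl /=.
by rewrite [RHS]bigfs ?index_enum_uniq // => ab _; rewrite mem_index_enum.
Qed.

End Main.

(** Since [floor(1 / n) = 0], only [l = 0] occurs, with [C(2, 1) = 2]. *)
Lemma torus_factor1 (F : numFieldType) n : (2 <= n)%N ->
  torus_factor F n 1 = n%:R / 2 - (n %% 2)%:R.
Proof.
move=> n2; rewrite /torus_factor /binomial_sum divn_small // big_ord1; cbv zeta.
rewrite subrr !mulr0 addr0 absz_nat bin1 (_ : 1%:Z - 1 = 0) // !expr0z !mul1r.
congr (_ - _); rewrite -[1.*2]/2%N.
by field.
Qed.

Theorem mainTheorem6 (R : realType) (p q : nat) (r s : int) (c : R[i])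
    (hp : (2 <= p)%N) (hq : (2 <= q)%N) (hpq : coprime p q)
    (hrs : p%:Z * s - q%:Z * r = 1)
    (hc : forall a b : nat,
      (0 < a < p)%N -> (0 < b < q)%N -> a = b %[mod 2] ->
      c <> (2 * cos (pi * (r%:~R * a%:R / p%:R + s%:~R * b%:R / q%:R)))%:C /\
      c <> (2 * cos (pi * (r%:~R * a%:R / p%:R - s%:~R * b%:R / q%:R)))%:C) :
  finite_set (acyclic_classes p q r s c) /\
  (forall m : nat,
    \sum_(X \in acyclic_classes p q r s c) (class_torsion X ^+ m)^-1
      = torus_factor R[i] p m * torus_factor R[i] q m /\
    exists z : int,
      \sum_(X \in acyclic_classes p q r s c) (class_torsion X ^+ m)^-1
        = z%:~R / 4 ^+ m) /\
  \sum_(X \in acyclic_classes p q r s c) (class_torsion X)^-1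
    = (p%:R / 2 - (p %% 2)%:R) * (q%:R / 2 - (q %% 2)%:R).
Proof.
have p_gt0 := ltnW hp; have q_gt0 := ltnW hq.
have sumE := sum_class_torsion p_gt0 q_gt0 hrs hc.
have zpP := zeta_exp R p_gt0; have zqP := zeta_exp R q_gt0.
have prim_p := zeta_prim R p_gt0; have prim_q := zeta_prim R q_gt0.
have four m : 4 ^+ m = 2 ^+ m * 2 ^+ m :> R[i].
  by rewrite -exprMn; congr (_ ^+ _); ring.
have factorE m : \sum_(X \in acyclic_classes p q r s c) (class_torsion X ^+ m)^-1
      = torus_factor R[i] p m * torus_factor R[i] q m.
  rewrite sumE (torus_factorE p_gt0 prim_p zpP) (torus_factorE q_gt0 prim_q zqP).
  by rewrite mulf_div four.
split.
  rewrite (acyclic_classesE p_gt0 q_gt0 hrs hc).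
  exact/finite_image/finite_finset.
split=> [m|].
  split=> //; rewrite sumE.
  have [k ->] := odd_chord_sum_int p_gt0 prim_p zpP m.
  have [l ->] := odd_chord_sum_int q_gt0 prim_q zqP m.
  by exists (k * l); rewrite intrM.
rewrite -(torus_factor1 _ hp) -(torus_factor1 _ hq) -factorE.
by apply: eq_fsbigr => X _; rewrite expr1.
Qed.
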